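(* Let $\mathbb{K}$ be a field of characteristic $0$, $R=\mathbb{K}[x_1,\dots,x_n]$, $P\subseteq R$ a maximal ideal and $I\subseteq R$ a $P$-primary ideal. (1) If $\{D_i\}_i$ spans $D_P[I]$ as a $\kappa(P)$-vector space, then any choice of preimages $\{N_i\}_i\subseteq W_R$ of $\{D_i\}_i$ under the natural map $W_R\to W_{\kappa(P)}$ is a set of Noetherian operators for $I$. (2) Conversely, if $\{N_i\}_i\subseteq W_R$ is a set of Noetherian operators for $I$, then their images in $W_{\kappa(P)}$ span $D_P[I]$ over $\kappa(P)$.
   Context: $W_R=R\langle\partial_1,\dots,\partial_n\rangle$ is the Weyl algebra ($\partial_i=\partial/\partial x_i$) acting on $R$ by differentiation/multiplication, written $D\bullet f$. A set $N\subseteq W_R$ is a set of Noetherian operators for an ideal $I$ if for all $f\in R$: $f\in I\iff D\bullet f\in\sqrt I$ for all $D\in N$. $W_{\kappa(P)}:=\kappa(P)\otimes_R W_R$, whose elements are $\sum_\alpha c_\alpha\partial^\alpha$ with $c_\alpha\in\kappa(P)$; the map $W_R\to W_{\kappa(P)}$ reduces coefficients modulo $P$. Pairing: $\langle\sum_\alpha c_\alpha\partial^\alpha,f\rangle=\sum_\alpha c_\alpha\overline{\partial^\alpha f}\in\kappa(P)$ for $f\in R$. Local dual space: $D_P[I]=\{D\in W_{\kappa(P)}:\langle D,f\rangle=0\ \forall f\in I\}$. *)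

(* Defs.v *)
From HB Require Import structures.
From mathcomp Require Import all_boot all_order all_algebra.
From mathcomp Require Import mpoly.
Set Implicit Arguments. Unset Strict Implicit. Unset Printing Implicit Defensive.
Import GRing.Theory.
Local Open Scope ring_scope.

Definition is_ideal (A : comRingType) (I : A -> Prop) : Prop :=
  [/\ I 0, (forall a b, I a -> I b -> I (a + b)) & (forall r a, I a -> I (r * a))].

Definition rad (A : comRingType) (I : A -> Prop) : A -> Prop :=
  fun f => exists m : nat, I (f ^+ m).

Definition is_maximal_ideal (A : comRingType) (P : A -> Prop) : Prop :=
  [/\ is_ideal P, ~ P 1 &
      forall J : A -> Prop, is_ideal J -> (forall a, P a -> J a) ->
        (forall a, J a <-> P a) \/ J 1].

Definition is_primary_ideal (A : comRingType) (I : A -> Prop) : Prop :=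
  [/\ is_ideal I, ~ I 1 &
      forall a b, I (a * b) -> I a \/ rad I b].

Definition is_P_primary (A : comRingType) (P I : A -> Prop) : Prop :=
  is_primary_ideal I /\ forall f, rad I f <-> P f.

(* Weyl algebra W_R: an element sum_alpha c_alpha d^alpha (c_alpha in R,
   written in normal form with coefficients on the left) is encoded by the
   polynomial sum_alpha c_alpha X^alpha in {mpoly R[n]}. *)
Definition weyl (K : fieldType) (n : nat) := {mpoly {mpoly K[n]}[n]}.

Definition weyl_act (K : fieldType) (n : nat) (D : weyl K n) (f : {mpoly K[n]})
  : {mpoly K[n]} :=
  \sum_(m <- msupp D) D@_m * mderivm m f.

Definition noetherian_ops (K : fieldType) (n : nat) (iota : Type)
  (N : iota -> weyl K n) (I : {mpoly K[n]} -> Prop) : Prop :=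
  forall f, I f <-> (forall i, rad I (weyl_act (N i) f)).

(* W_{kappa(P)}: kappa(P) is represented by a field L with a surjective ring
   morphism pi : R -> L whose kernel is P; elements sum c_alpha d^alpha
   (c_alpha in L) are encoded in {mpoly L[n]}. The reduction W_R -> W_kappa(P)
   is map_mpoly pi. *)
Definition weyl_red (K : fieldType) (n : nat) (L : fieldType)
  (pi : {rmorphism {mpoly K[n]} -> L}) (D : weyl K n) : {mpoly L[n]} :=
  map_mpoly pi D.

Definition pairing (K : fieldType) (n : nat) (L : fieldType)
  (pi : {rmorphism {mpoly K[n]} -> L}) (E : {mpoly L[n]}) (f : {mpoly K[n]}) : L :=
  \sum_(m <- msupp E) E@_m * pi (mderivm m f).

Definition local_dual (K : fieldType) (n : nat) (L : fieldType)
  (pi : {rmorphism {mpoly K[n]} -> L}) (I : {mpoly K[n]} -> Prop)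
  (E : {mpoly L[n]}) : Prop :=
  forall f, I f -> pairing pi E f = 0.

Definition in_span (L : fieldType) (V : lmodType L) (iota : Type)
  (F : iota -> V) (v : V) : Prop :=
  exists (s : seq iota) (c : iota -> L), v = \sum_(i <- s) c i *: F i.

Definition spans (L : fieldType) (V : lmodType L) (iota : Type)
  (F : iota -> V) (S : V -> Prop) : Prop :=
  forall v, S v <-> in_span F v.

(* Main.v *)
(* Let [a] in [L^n] be the point defined by [pi] and [tau : R -> L[y]] the Taylor
   expansion [f |-> f(a + y)], so that [pi (d^m f)] is [m!] times the coefficient
   of [y^m] in [tau f].  By Zariski's lemma and the primitive element theorem,
   [L = K(z)].  Newton iteration lifts [z] to an [x] in [R] whose Taylor expansion
   is constant to any given order, and at which the minimal polynomial of [z]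
   takes a value in [I].  Hence [tau] is onto modulo every power of
   [M = (y_1, ..., y_n)], and [tau f] in [M^k] implies [f] in [I] for some [k].
   So [I] is the preimage of a subspace [J] of the finite-dimensional [L]-space
   [L[y]/M^k], the local dual is the annihilator of [J], and a family of operators
   is Noetherian iff it spans this annihilator. *)
Require Import Defs.
From HB Require Import structures.
From mathcomp Require Import all_boot all_order all_algebra.
From mathcomp Require Import mpoly.
From mathcomp Require Import ssrcomplements separable ring.
From Stdlib Require Import Classical ClassicalEpsilon.
Import GRing.Theory.
Local Open Scope ring_scope.

(** * Zariski's lemma *)

(** The ring [phi(A)[b]] enters only as the image of this evaluation, so towers of extensions need
    no subring structures. *)
Definition adjoin {A B : comNzRingType} (phi : {rmorphism A -> B})
  (b : B) : {rmorphism {poly A} -> B} := horner_eval b \o map_poly phi.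

Lemma adjoinE (A B : comNzRingType) (phi : {rmorphism A -> B}) b p :
  adjoin phi b p = (map_poly phi p).[b].
Proof. by []. Qed.

Lemma adjoinC (A B : comNzRingType) (phi : {rmorphism A -> B}) b c :
  adjoin phi b c%:P = phi c.
Proof. by rewrite adjoinE map_polyC hornerC. Qed.

Definition integral_over_localization {A : comNzRingType} {L : fieldType}
  (phi : {rmorphism A -> L}) : Prop :=
  exists2 s, phi s != 0 & integralRange (adjoin phi (phi s)^-1).

Definition fraction {A : comNzRingType} {L : fieldType}
  (phi : {rmorphism A -> L}) (s : A) (x : L) : Prop :=
  exists k a, phi s ^+ k * x = phi a.

Section Localization.
Context {A : comNzRingType} {L : fieldType} (phi : {rmorphism A -> L}).
Implicit Types (s a : A) (x y : L).

Lemma coef_map_adjoin b (p : {poly {poly A}}) i :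
  (map_poly (adjoin phi b) p)`_i = (map_poly phi p`_i).[b].
Proof. exact: (coef_map (adjoin phi b)). Qed.

Lemma fraction_phi s a : fraction phi s (phi a).
Proof. by exists 0%N, a; rewrite expr0 mul1r. Qed.

Lemma fractionD s x y :
  fraction phi s x -> fraction phi s y -> fraction phi s (x + y).
Proof.
move=> [k [a ka]] [l [b lb]]; exists (k + l)%N, (s ^+ l * a + s ^+ k * b).
by rewrite rmorphD !rmorphM !rmorphXn -ka -lb exprD; ring.
Qed.

Lemma fractionM s x y :
  fraction phi s x -> fraction phi s y -> fraction phi s (x * y).
Proof.
move=> [k [a ka]] [l [b lb]]; exists (k + l)%N, (a * b).
by rewrite rmorphM -ka -lb exprD; ring.
Qed.

Lemma fractionX s x k : fraction phi s x -> fraction phi s (x ^+ k).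
Proof.
move=> fx; elim: k => [|k IHk]; last by rewrite exprS; apply: fractionM.
by rewrite expr0 -(rmorph1 phi); apply: fraction_phi.
Qed.

Lemma fraction_sum s m (F : 'I_m -> L) :
  (forall i, fraction phi s (F i)) -> fraction phi s (\sum_i F i).
Proof.
move=> fF; apply: (big_ind (fraction phi s)) => // [|x y].
  by rewrite -(rmorph0 phi); apply: fraction_phi.
exact: fractionD.
Qed.

Lemma fraction_adjoin s (q : {poly A}) :
  phi s != 0 -> fraction phi s (adjoin phi (phi s)^-1 q).
Proof.
move=> s0; rewrite adjoinE horner_coef; apply: fraction_sum => i.
rewrite coef_map; apply: fractionM; first exact: fraction_phi.
by apply: fractionX; exists 1%N, 1; rewrite expr1 divff ?rmorph1.
Qed.

Lemma fraction_mull s t x : fraction phi s x -> fraction phi (s * t) x.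
Proof.
move=> [k [a ka]]; exists k, (t ^+ k * a).
by rewrite !rmorphM rmorphXn -ka exprMn; ring.
Qed.

Lemma integral_fraction s x : phi s != 0 ->
  fraction phi s x -> integralOver (adjoin phi (phi s)^-1) x.
Proof.
move=> s0 [k [a ka]]; suff -> : x = adjoin phi (phi s)^-1 (a *: 'X^k).
  exact: integral_id.
rewrite adjoinE map_polyZ map_polyXn !hornerE -ka exprVn.
by rewrite mulrAC divff ?mul1r // expf_neq0.
Qed.

Lemma integral_root_fraction s (p : {poly L}) x : phi s != 0 ->
    p \is monic -> root p x -> (forall i, fraction phi s p`_i) ->
  integralOver (adjoin phi (phi s)^-1) x.
Proof.
move=> s0 mp px fp; apply: (integral_root_monic mp px).
by apply/integral_poly => i; apply: integral_fraction.
Qed.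

Lemma integral_fractionP s x : phi s != 0 ->
    integralOver (adjoin phi (phi s)^-1) x ->
  exists p : {poly L}, [/\ p \is monic, root p x & forall i, fraction phi s p`_i].
Proof.
move=> s0 [p mp px]; exists (map_poly (adjoin phi (phi s)^-1) p).
by split=> // [|i]; rewrite ?monic_map // coef_map; apply: fraction_adjoin.
Qed.

Lemma integral_mull s t x : phi (s * t) != 0 ->
    integralOver (adjoin phi (phi s)^-1) x ->
  integralOver (adjoin phi (phi (s * t))^-1) x.
Proof.
move=> st0; have s0 : phi s != 0.
  by apply: contraNneq st0 => s0; rewrite rmorphM s0 mul0r.
move=> /(integral_fractionP _ _ s0)[p [mp px fp]].
apply: (@integral_root_fraction _ p) => // i; exact: fraction_mull.
Qed.

(** Multiplying a monic equation of degree [d] for [1/u] by [u^d] gives [1 + u w = 0] with [w] in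
    [A[1/s]]; clearing the denominator of [w] makes [u] divide a power of [s]. *)
Lemma integral_inv_dvd s u : phi s != 0 -> phi u != 0 ->
    integralOver (adjoin phi (phi s)^-1) (phi u)^-1 ->
  exists k a, phi s ^+ k = phi (u * a).
Proof.
move=> s0 u0 /(integral_fractionP _ _ s0)[p [mp /rootP px fp]].
pose d := (size p).-1.
have sp : size p = d.+1 by rewrite /d prednK // lt0n size_poly_eq0 monic_neq0.
have [k [a ka]]: fraction phi s (\sum_(i < d) p`_i * phi u ^+ (d - i.+1)).
  apply: fraction_sum => i; apply: fractionM (fp i) _.
  by apply: fractionX; apply: fraction_phi.
exists k, (- a); rewrite mulrN rmorphN rmorphM -ka mulrCA -mulrN.
rewrite -[LHS]mulr1; congr (_ * _); apply/eqP; rewrite -addr_eq0; apply/eqP.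
transitivity (phi u ^+ d * p.[(phi u)^-1]); last by rewrite px mulr0.
rewrite horner_coef sp big_ord_recr /=.
have -> : p`_d = 1 by rewrite -(monicP mp) lead_coefE /d.
rewrite mul1r mulrDr -exprMn divff // expr1n [RHS]addrC !mulr_sumr.
congr (_ + _); apply: eq_bigr => i _.
rewrite mulrCA [RHS]mulrCA; congr (_ * _).
rewrite -exprS subnSK // expfB_cond; first by rewrite exprVn.
by rewrite (negPf u0) ltnW ?ltn_ord.
Qed.

Lemma fraction_root_coef0 s x (p : {poly L}) : x != 0 ->
    p \is monic -> root p x -> (forall i, fraction phi s p`_i) ->
  exists q : {poly L}, [/\ q`_0 != 0, root q x & forall i, fraction phi s q`_i].
Proof.
move=> x0 mp px fp; have {mp} := monic_neq0 mp; elim/poly_ind: p px fp => [|p c IHp].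
  by rewrite eqxx.
have [->|c0] := eqVneq c 0.
  rewrite addr0 rootM rootX (negPf x0) orbF => px fp pX0; apply: IHp => //.
    by move=> i; have := fp i.+1; rewrite coefMX.
  by apply: contraNneq pX0 => ->; rewrite mul0r.
by move=> px fp _; exists (p * 'X + c%:P); rewrite coefD coefMX coefC add0r.
Qed.

(** An equation [r(x) x + q_0 = 0] with [q_0] nonzero gives [1/x = - r(x) / q_0]. Inverting also the
    numerator [t] of [q_0] brings [1/q_0] into the localization. *)
Lemma integral_inv_localize s x : phi s != 0 -> x != 0 ->
    integralOver (adjoin phi (phi s)^-1) x ->
  exists2 t, phi (s * t) != 0 &
    integralOver (adjoin phi (phi (s * t))^-1) x^-1.
Proof.
move=> s0 x0 intx; have [p [mp px fp]] := integral_fractionP _ _ s0 intx.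
have [q [q0 qx fq]] := fraction_root_coef0 _ _ _ x0 mp px fp.
have [k [t kt]] := fq 0%N.
have t0 : phi t != 0 by rewrite -kt mulf_neq0 ?expf_neq0.
have st0 : phi (s * t) != 0 by rewrite rmorphM mulf_neq0.
exists t => //; pose r := \poly_(i < (size q).-1) q`_i.+1.
have qE : q = r * 'X + (q`_0)%:P.
  apply/polyP=> [[|i]]; rewrite coefD coefMX coefC ?add0r //= addr0 coef_poly.
  case: ltnP => // lei; rewrite nth_default //.
  by move: lei; case: (size q).
have -> : x^-1 = - (r.[x] * (q`_0)^-1).
  apply: (mulfI (mulf_neq0 x0 q0)); move/rootP: qx; rewrite {1}qE !hornerE => qx.
  rewrite mulrAC divff // mul1r mulrN mulrACA divff // mulr1 mulrC.
  by apply/esym/eqP; rewrite eqr_oppLR -addr_eq0 qx.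
apply/integral_opp/integral_mul.
  apply: integral_horner; last exact: integral_mull.
  apply/integral_poly => i; apply: integral_fraction => //.
  apply: fraction_mull; rewrite coef_poly; case: ifP => // _.
  by rewrite -(rmorph0 phi); apply: fraction_phi.
(* As [q_0 = t / s^k], its inverse is [s^(k+1) / (s t)]. *)
apply: integral_fraction => //; exists 1%N, (s ^+ k.+1).
have -> : q`_0 = phi t / phi s ^+ k.
  by rewrite -kt mulrAC divff ?mul1r // expf_neq0.
by rewrite expr1 invf_div rmorphM rmorphXn mulrACA divff // mulr1 exprS.
Qed.

End Localization.

(* If [L] is integral over [A[b][1/s]], then [b] is algebraic over [A]:
   otherwise [1 + s b] would divide a power of [s] in the polynomial ring
   [A[b]], to which it is coprime. *)
Lemma adjoin_algebraic (A : comNzRingType) (L : fieldType)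
    (phi : {rmorphism A -> L}) b :
  integral_over_localization (adjoin phi b) ->
  exists2 p : {poly A}, map_poly phi p != 0 & adjoin phi b p = 0.
Proof.
move=> [s s0 ints]; apply: NNPP => trb.
have inj p : adjoin phi b p = 0 -> map_poly phi p = 0.
  by move=> p0; apply/eqP/negP => /negP pn0; apply: trb; exists p.
have snz : map_poly phi s != 0.
  by apply: contraNneq s0 => s00; rewrite adjoinE s00 horner0.
pose u := 1 + s * 'X.
have uE : map_poly phi u = map_poly phi s * 'X + 1%:P.
  by rewrite rmorphD rmorphM /= map_polyX rmorph1 addrC.
have szu : (1 < size (map_poly phi u))%N.
  by rewrite uE size_MXaddC (negPf snz) /= ltnS lt0n size_poly_eq0.
have u0 : adjoin phi b u != 0.
  by apply: contraTneq szu => /inj ->; rewrite size_poly0.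
have [k [a ka]] := integral_inv_dvd _ s u s0 u0 (ints _).
have {ka} : map_poly phi s ^+ k = map_poly phi u * map_poly phi a.
  apply/eqP; rewrite -subr_eq0 -rmorphXn -rmorphM -rmorphB /=.
  by apply/eqP/inj; rewrite rmorphB rmorphXn ka subrr.
move=> /(congr1 (dvdp (map_poly phi u))); rewrite dvdp_mulIl => /idP us.
have cop : coprimep (map_poly phi u) (map_poly phi s ^+ k).
  apply: coprimep_expr; apply/Bezout_eq1_coprimepP; exists (1, - 'X) => /=.
  by rewrite uE; ring.
move/coprimepP: cop => /(_ _ (dvdpp _) us); rewrite -size_poly_eq1 => /eqP u1.
by rewrite u1 in szu.
Qed.

(** Being algebraic, [b] is integral once a leading coefficient [c] is inverted. So is [s], a
    polynomial in [b], and [1/s] becomes integral after inverting a further [t]. Integrality over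
    [A[b][1/s]] then descends to [A[1/(ct)]] by transitivity. *)
Lemma integral_over_localization_descend (A : comNzRingType) (L : fieldType)
    (phi : {rmorphism A -> L}) b :
  integral_over_localization (adjoin phi b) -> integral_over_localization phi.
Proof.
move=> intb; have [p p0 pb] := adjoin_algebraic _ _ _ _ intb.
have [s s0 ints] := intb.
have [c c0 cb] : exists2 c, phi c != 0 & integralOver (adjoin phi (phi c)^-1) b.
  have lc0 : lead_coef (map_poly phi p) != 0 by rewrite lead_coef_eq0.
  exists p`_(size (map_poly phi p)).-1; first by rewrite -coef_map -lead_coefE.
  rewrite -coef_map -lead_coefE.
  have c0 : phi p`_(size (map_poly phi p)).-1 != 0 by rewrite -coef_map -lead_coefE.
  rewrite lead_coefE coef_map.
  apply: (@integral_root_fraction _ _ _ _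
            ((lead_coef (map_poly phi p))^-1 *: map_poly phi p)) => //.
  - by rewrite monicE lead_coefZ mulVf.
  - by rewrite rootZ ?invr_eq0 //; apply/rootP.
  move=> i; rewrite coefZ coef_map; apply: fractionM (fraction_phi _ _ _).
  exists 1%N, 1; rewrite expr1 rmorph1 -coef_map -lead_coefE divff //.
have intsb : integralOver (adjoin phi (phi c)^-1) (adjoin phi b s).
  rewrite adjoinE; apply: integral_horner => //; apply/integral_poly => i.
  by rewrite coef_map; apply: integral_fraction (fraction_phi _ _ _).
have [t t0 intV] := integral_inv_localize _ _ _ c0 s0 intsb.
exists (c * t) => // y; have [P mP Py] := ints y.
apply: integral_root_monic Py _; first by rewrite monic_map.
apply/integral_poly => i; rewrite coef_map adjoinE.
apply: integral_horner => //; apply/integral_poly => j; rewrite coef_map_adjoin.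
apply: integral_horner; last exact: integral_mull.
apply/integral_poly => l; rewrite coef_map.
exact: integral_fraction (fraction_phi _ _ _).
Qed.

(** [L = phi(A)[bs]], with the generators adjoined one by one so that Zariski's lemma is an
    induction on [bs]. *)
Fixpoint generated {L : fieldType} {A : comNzRingType}
    (phi : {rmorphism A -> L}) (bs : seq L) : Prop :=
  if bs is b :: bs' then generated (adjoin phi b) bs'
  else forall y, exists a, phi a = y.

Lemma generated_integral_over_localization (L : fieldType) (bs : seq L)
    (A : comNzRingType) (phi : {rmorphism A -> L}) :
  generated phi bs -> integral_over_localization phi.
Proof.
elim: bs A phi => [|b bs IHbs] A phi /= gen.
  exists 1; first by rewrite rmorph1 oner_neq0.
  move=> y; have [a <-] := gen y; apply: integral_fraction (fraction_phi _ _ _).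
  by rewrite rmorph1 oner_neq0.
exact: integral_over_localization_descend (IHbs _ _ gen).
Qed.

(** Over a field the localization adds nothing: the inverse of [iota s] is already in the image of
    [iota]. *)
Lemma zariski (K L : fieldType) (iota : {rmorphism K -> L}) (bs : seq L) :
  generated iota bs -> forall y, algebraicOver iota y.
Proof.
move=> /generated_integral_over_localization[s s0 ints] y.
apply/integral_algebraic; have [p mp py] := ints y.
apply: integral_root_monic py _; first exact: monic_map.
apply/integral_poly => i; rewrite coef_map_adjoin -fmorphV horner_map.
exact: integral_id.
Qed.

Lemma generated_subalgebra (L : fieldType) (A : comNzRingType)
    (phi : {rmorphism A -> L}) (bs : seq L) :
  (forall S : L -> Prop, (forall a, S (phi a)) -> {in bs, forall b, S b} ->
     (forall x y, S x -> S y -> S (x + y)) ->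
     (forall x y, S x -> S y -> S (x * y)) -> forall x, S x) ->
  generated phi bs.
Proof.
elim: bs A phi => [|b bs IHbs] A phi /= gen.
  move=> y; apply: (gen (fun y => exists a, phi a = y)) => //.
  - by move=> a; exists a.
  - by move=> _ _ [a <-] [b <-]; exists (a + b); rewrite rmorphD.
  - by move=> _ _ [a <-] [b <-]; exists (a * b); rewrite rmorphM.
apply: IHbs => S S0 Sb SD SM; apply: gen => // [a|c].
  by have := S0 a%:P; rewrite adjoinC.
rewrite inE => /predU1P[->|/Sb //].
by have := S0 'X; rewrite adjoinE map_polyX hornerX.
Qed.

Lemma mpoly_algebra_ind (n : nat) (A : comNzRingType) (S : {mpoly A[n]} -> Prop) :
    (forall c, S c%:MP) -> (forall i, S 'X_i) ->
    (forall f g, S f -> S g -> S (f + g)) ->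
    (forall f g, S f -> S g -> S (f * g)) ->
  forall f, S f.
Proof.
move=> SC SX SD SM; elim/mpolyind=> [|c m f _ _ Sf].
  by rewrite -mpolyC0; apply: SC.
rewrite -mul_mpolyC; apply: (SD) => //; apply: (SM); first exact: SC.
rewrite mpolyXE_id; apply: (big_ind S) => [|u v|i _]; last 1 first.
- elim: (m i) => [|k IHk]; last by rewrite exprS; apply: (SM).
  by rewrite expr0 -mpolyC1; apply: SC.
- by rewrite -mpolyC1; apply: SC.
exact: (SM).
Qed.

Lemma mpoly_quotient_algebraic (K L : fieldType) (n : nat)
    (pi : {rmorphism {mpoly K[n]} -> L}) :
  (forall y, exists f, pi f = y) -> forall y, algebraicOver (pi \o @mpolyC n K) y.
Proof.
move=> surj; apply: (@zariski _ _ _ (codom (fun i => pi 'X_i))).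
apply: generated_subalgebra => S S0 Sb SD SM x; have [f <-] := surj x.
elim/mpoly_algebra_ind: f => [c|i|f g Sf Sg|f g Sf Sg]; first exact: S0.
- exact/Sb/codom_f.
- by rewrite rmorphD; apply: (SD).
- by rewrite rmorphM; apply: (SM).
Qed.

(** * Primitive elements *)

(** The two-generator theorem replaces the previous primitive element [x] and the new [b] by one
    [z]; polynomials in [x] become polynomials in [z] by composition. *)
Lemma primitive_element_seq (K L : fieldType) (iota : {rmorphism K -> L})
    (bs : seq L) :
    [pchar K] =i pred0 -> (forall y, algebraicOver iota y) ->
  exists z, forall b, b \in bs -> exists q, (map_poly iota q).[z] = b.
Proof.
move=> charK alg; elim: bs => [|b bs [x xP]]; first by exists 0.
have [[p p0 px] [q q0 qb]] := (alg x, alg b).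
have [k [[r rx] [t tb]]] := pchar0_PET p0 px q0 qb charK.
set z := b *+ k - x in rx tb; exists z => c; rewrite inE => /predU1P[->|].
  by exists t.
move=> /xP[u <-]; exists (u \Po r).
by rewrite map_comp_poly horner_comp rx.
Qed.

Lemma primitive_element_quotient (K L : fieldType) (n : nat)
    (pi : {rmorphism {mpoly K[n]} -> L}) :
    [pchar K] =i pred0 -> (forall y, exists f, pi f = y) ->
  exists z, forall y, exists q, (map_poly (pi \o @mpolyC n K) q).[z] = y.
Proof.
move=> charK surj; have alg := mpoly_quotient_algebraic K L n pi surj.
have [z zP] := primitive_element_seq _ _ _ (codom (fun i => pi 'X_i)) charK alg.
exists z => y; have [f <-] := surj y.
elim/mpoly_algebra_ind: f => [c|i|f g [p pf] [q qg]|f g [p pf] [q qg]].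
- by exists c%:P; rewrite map_polyC hornerC.
- exact/zP/codom_f.
- by exists (p + q); rewrite !rmorphD hornerD pf qg.
- by exists (p * q); rewrite !rmorphM hornerM pf qg.
Qed.

(** Take [p] of least degree vanishing at [z], and [p = e * gcd(p, p')]. If [z] were a root of the
    gcd, [p] would divide [p'], which is nonzero of smaller degree; so [p] divides [e] and the gcd
    is constant. *)
Lemma minimal_polynomial (K L : fieldType) (iota : {rmorphism K -> L}) z :
    [pchar K] =i pred0 -> algebraicOver iota z ->
  exists p : {poly K}, coprimep p p^`() /\
    forall q, (map_poly iota q).[z] = 0 <-> p %| q.
Proof.
move=> /pcharf0P charK [p0 p00 /rootP p0z].
have [p [pn0 pz pmin]] : exists p : {poly K}, [/\ p != 0, (map_poly iota p).[z] = 0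
    & forall q, (map_poly iota q).[z] = 0 -> (size q < size p)%N -> q = 0].
  elim: (size p0) {-2}p0 (leqnn (size p0)) p00 p0z => [|k IHk] p.
    by rewrite leqn0 size_poly_eq0 => /eqP ->; rewrite eqxx.
  move=> szp pn0 pz; have [[q [q0 qz szq]]|noq] := classic (exists q : {poly K},
      [/\ q != 0, (map_poly iota q).[z] = 0 & (size q < size p)%N]).
    by apply: (IHk q) => //; rewrite -ltnS (leq_trans szq).
  exists p; split=> // q qz szq; apply/eqP/negP => /negP q0.
  by apply: noq; exists q.
have pdvd q : (map_poly iota q).[z] = 0 <-> p %| q.
  split=> [qz|/dvdpP[r ->]]; last by rewrite rmorphM hornerM pz mulr0.
  rewrite /dvdp (pmin (q %% p)) ?ltn_modp //.
  have := congr1 (fun r => (map_poly iota r).[z]) (divp_eq q p).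
  by rewrite rmorphD rmorphM hornerD hornerM pz mulr0 add0r qz.
exists p; split=> //.
have szp : (1 < size p)%N.
  rewrite ltnNge; apply: contra pn0 => /size1_polyC pE.
  move: pz; rewrite pE map_polyC hornerC => /eqP.
  by rewrite fmorph_eq0 polyC_eq0.
(* In characteristic 0 the top coefficient of [p] survives derivation. *)
have dp0 : p^`() != 0.
  apply: contraTneq szp => dp0; have := congr1 (fun r : {poly K} => r`_(size p).-2) dp0.
  rewrite -leqNgt coef_deriv coef0 -mulr_natr => /eqP.
  case szE: (size p) => [|[|k]] //=; rewrite mulf_eq0 charK orbF.
  have -> : p`_k.+1 = lead_coef p by rewrite lead_coefE szE.
  by rewrite lead_coef_eq0 (negPf pn0).
have ndvd : ~~ (p %| p^`()).
  apply: contraNN dp0 => /pdvd dpz; rewrite (pmin _ dpz) // lt_size_deriv //.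
have /dvdpP[e eE] := dvdp_gcdl p p^`().
have := pz; rewrite {1}eE rmorphM hornerM => /eqP; rewrite mulf_eq0.
case/orP=> /eqP /pdvd; last first.
  by move=> /dvdp_trans/(_ (dvdp_gcdr _ _)); rewrite (negPf ndvd).
move=> pe; rewrite /coprimep.
have e0 : e != 0 by apply: contraNneq pn0 => e0; rewrite eE e0 mul0r.
have g0 : gcdp p p^`() != 0 by rewrite gcdp_eq0 (negPf pn0).
move: (dvdp_leq e0 pe); rewrite {1}eE size_mul // => le.
have := size_poly_gt0 (gcdp p p^`()); rewrite g0 => gt.
have := size_poly_gt0 e; rewrite e0 => gte.
move: le gt gte; case: (size (gcdp _ _)) => [|[|k]] //.
by case: (size e) => // j; rewrite addSn /= !addnS !ltnS ltnNge leq_addr.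
Qed.

(** * Newton iteration *)

Lemma comp_poly_taylor1 (A : comNzRingType) (p a d : {poly A}) :
  exists e, p \Po (a + d) = p \Po a + (p^`() \Po a) * d + d ^+ 2 * e.
Proof.
elim/poly_ind: p => [|p c [e eE]].
  by exists 0; rewrite deriv0 !comp_poly0; ring.
exists (e * (a + d) + (p^`() \Po a)).
rewrite derivD derivC addr0 derivM derivX mulr1.
rewrite !comp_polyD !comp_polyM !comp_polyX !comp_polyC eE.
by ring.
Qed.

(** Newton's step uses [v(h)] for the inverse of [p'(h)], where [u p + v p' = 1]. The terms up to
    first order leave [u(h) p(h)^2], so the new value of [p] is a multiple of [p(h)^2]. *)
Lemma newton_approximation (K : fieldType) (p : {poly K}) k : coprimep p p^`() ->
  exists h, p ^+ k %| p \Po h /\ p %| h - 'X.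
Proof.
move=> /Bezout_eq1_coprimepP[[u v] /= uvE].
(* The exponent starts at 1, as given by [h = X]; keeping [h] congruent to [X] uses that [p] divides
   [p(h)]. *)
suff [h []] : exists h, p ^+ k.+1 %| p \Po h /\ p %| h - 'X.
  by move=> ph pX; exists h; split=> //; apply: dvdp_trans ph; apply: dvdp_exp2l.
elim: k => [|k [h [ph pX]]].
  by exists 'X; rewrite expr1 comp_polyXr subrr dvdp0.
have [e eE] := comp_poly_taylor1 _ p h (- ((v \Po h) * (p \Po h))).
exists (h - (v \Po h) * (p \Po h)); split; last first.
  rewrite addrAC dvdp_add // dvdpNr dvdp_mull //.
  by apply: dvdp_trans ph; rewrite exprS dvdp_mulr.
have uvh : (u \Po h) * (p \Po h) + (v \Po h) * (p^`() \Po h) = 1.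
  by rewrite -!comp_polyM -comp_polyD uvE comp_polyC.
have -> : p \Po (h - (v \Po h) * (p \Po h)) =
    (p \Po h) ^+ 2 * ((u \Po h) + (v \Po h) ^+ 2 * e).
  rewrite eE -[X in X + _ * - _]mulr1 -uvh; ring.
apply: dvdp_mulr; apply: (@dvdp_trans _ ((p ^+ k.+1) ^+ 2)).
  by rewrite -exprM dvdp_exp2l // muln2 -addnn addSn addnS ltnS leq_addr.
by rewrite !expr2 dvdp_mul.
Qed.

(** Over [L], [p = q * (X - z)] with [q(z)] nonzero, since [z] is a simple root. In
    [p(h) = q(h) * (h - z)] the factor [q(h)] is coprime to [X - z], so the whole power of [X - z]
    divides [h - z]. *)
Lemma newton_approximation_root (K L : fieldType) (iota : {rmorphism K -> L})
    (p h : {poly K}) (z : L) k :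
    coprimep p p^`() -> (map_poly iota p).[z] = 0 ->
    p ^+ k %| p \Po h -> p %| h - 'X ->
  ('X - z%:P) ^+ k %| map_poly iota h - z%:P.
Proof.
move=> cop pz ph pX; pose P := map_poly iota p; pose H := map_poly iota h.
have /factor_theorem[q qE] : root P z by apply/rootP.
have Hz : H.[z] = z.
  have /dvdpP[r rE] := pX; apply/eqP; rewrite -subr_eq0; apply/eqP.
  have := congr1 (fun r => (map_poly iota r).[z]) rE.
  by rewrite rmorphM rmorphB /= map_polyX !hornerE pz mulr0.
have qz : q.[z] != 0.
  have copL : coprimep P P^`() by rewrite deriv_map coprimep_map.
  have /(coprimep_root copL) : root P z by apply/rootP.
  by apply: contraNneq => qz; rewrite qE derivM derivB derivX derivC !hornerE qz
    subrr mulr0 mul0r addr0.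
have dvdL : ('X - z%:P) ^+ k %| P \Po H.
  rewrite -map_comp_poly; apply: (@dvdp_trans _ (P ^+ k)).
    by rewrite dvdp_exp2r // qE dvdp_mull.
  by rewrite -rmorphXn dvdp_map.
move: dvdL; rewrite qE comp_polyM comp_polyB comp_polyX comp_polyC.
rewrite Gauss_dvdpr // coprimep_expl //.
by rewrite coprimep_sym coprimep_XsubC rootE horner_comp Hz.
Qed.

(** * Taylor expansion at the point defined by [pi] *)

Definition order_ge {A : comNzRingType} {n : nat} (k : nat) (g : {mpoly A[n]}) : Prop :=
  forall m, (mdeg m < k)%N -> g@_m = 0.

Section Order.
Context {A : comNzRingType} {n : nat}.
Implicit Types (f g : {mpoly A[n]}) (k l : nat).

Lemma order_geD k f g : order_ge k f -> order_ge k g -> order_ge k (f + g).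
Proof. by move=> kf kg m lt; rewrite mcoeffD kf // kg // addr0. Qed.

Lemma order_geN k f : order_ge k f -> order_ge k (- f).
Proof. by move=> kf m lt; rewrite mcoeffN kf // oppr0. Qed.

Lemma order_geM k l f g : order_ge k f -> order_ge l g -> order_ge (k + l) (f * g).
Proof.
move=> kf lg m lt; rewrite mcoeffM big1 // => -[u v] /= /eqP mE.
have [ltu|leu] := ltnP (mdeg u) k; first by rewrite kf // mul0r.
rewrite lg ?mulr0 //; have := congr1 mdeg mE; rewrite mdegD => mE'.
rewrite mE' in lt; by rewrite -(ltn_add2l k) (leq_ltn_trans _ lt) // leq_add2r.
Qed.

Lemma order_ge_mull k f g : order_ge k g -> order_ge k (f * g).
Proof. by move=> kg; apply: (@order_geM 0). Qed.

Lemma order_ge1P f : order_ge 1 f <-> f@_0%MM = 0.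
Proof.
split=> [->//|f0 m]; first by rewrite mdeg0.
by rewrite ltnS leqn0 mdeg_eq0 => /eqP ->.
Qed.

Lemma order_geX k f : order_ge 1 f -> order_ge k (f ^+ k).
Proof.
by move=> f1; elim: k => // k IHk; rewrite exprS -add1n; apply: order_geM.
Qed.

End Order.

Definition taylor {K L : fieldType} {n : nat} (pi : {rmorphism {mpoly K[n]} -> L}) :
  {rmorphism {mpoly K[n]} -> {mpoly L[n]}} :=
  mmap (@mpolyC n L \o (pi \o @mpolyC n K)) (fun i => (pi 'X_i)%:MP + 'X_i).

Section Taylor.
Context {K L : fieldType} {n : nat} (pi : {rmorphism {mpoly K[n]} -> L}).
Local Notation iota := (pi \o @mpolyC n K).
Local Notation tau := (taylor pi).

Lemma taylorC c : tau c%:MP = (pi c%:MP)%:MP.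
Proof. exact: mmapC. Qed.

Lemma taylorX i : tau 'X_i = (pi 'X_i)%:MP + 'X_i.
Proof. by rewrite /taylor /= mmapX mmap1U. Qed.

Lemma taylor_coef0 f : (tau f)@_0%MM = pi f.
Proof.
elim/mpoly_algebra_ind: f => [c|i|f g IHf IHg|f g IHf IHg].
- by rewrite taylorC mcoeffC eqxx mulr1.
- by rewrite taylorX mcoeffD mcoeffC eqxx mulr1 mcoeffX mnm1_eq0 addr0.
- by rewrite rmorphD mcoeffD rmorphD IHf IHg.
- by rewrite [tau _]rmorphM [LHS](rmorphM (mcoeff 0%MM)) rmorphM -IHf -IHg.
Qed.

Lemma mderivXU (A : comNzRingType) (i j : 'I_n) :
  ('X_j : {mpoly A[n]})^`M(i) = (i == j)%:R.
Proof.
rewrite mderivX mnm1E eq_sym; have [->|_] := eqVneq i j; last by rewrite scale0r.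
rewrite scale1r (_ : (U_(j) - U_(j))%MM = 0%MM) ?mpolyX0 //.
by apply/mnmP => l; rewrite mnmBE subnn mnm0E.
Qed.

Lemma taylor_mderiv i f : tau (f^`M(i)) = (tau f)^`M(i).
Proof.
elim/mpoly_algebra_ind: f => [c|j|f g IHf IHg|f g IHf IHg].
- by rewrite taylorC !mderivC rmorph0.
- by rewrite taylorX mderivD mderivC add0r !mderivXU rmorph_nat.
- by rewrite !(mderivD, rmorphD) /= IHf IHg.
- by rewrite rmorphM !mderivM rmorphD !rmorphM /= IHf IHg.
Qed.

Lemma taylor_mderivm m f : tau (f^`M[m]) = (tau f)^`M[m].
Proof.
rewrite /mderivm; elim: (enum _) => //= i s <-.
by elim: (m i) => //= k <-; rewrite -taylor_mderiv.
Qed.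

Lemma pi_mderivm m f : pi (f^`M[m]) = (tau f)@_m *+ (\prod_(i < n) (m i)`!).
Proof.
rewrite -taylor_coef0 taylor_mderivm mcoeff_mderivm addm0; congr (_ *+ _).
by apply: eq_bigr => i _; rewrite ffactnn.
Qed.

End Taylor.

(** * Approximation by Taylor expansions, and elements of high Taylor order *)

Lemma mpoly_extension {n : nat} {A B : comNzRingType} (phi : {rmorphism A -> B})
    (h : 'I_n -> B) :
  exists s : {rmorphism {mpoly A[n]} -> B},
    (forall c, s c%:MP = phi c) /\ (forall i, s 'X_i = h i).
Proof.
by exists (mmap phi h); split=> [c|i] /=; rewrite (mmapC, mmapX) ?mmap1U.
Qed.

(** A monomial of degree above [n * max e] contains some [y_i] to at least the power [e_i], so its
    value is in [I]; terms of lower degree are in [I] through their coefficients. *)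
Lemma mmap_ideal {n : nat} {A B : comNzRingType} (phi : {rmorphism A -> B})
    (I : B -> Prop) (y : 'I_n -> B) (e : 'I_n -> nat) (g : {mpoly A[n]}) :
    is_ideal I -> (forall i, I (y i ^+ e i)) ->
    (forall m, (mdeg m < (n * \max_i e i).+1)%N -> I (phi g@_m)) ->
  I (mmap phi y g).
Proof.
move=> [I0 ID IM] eP Ig; rewrite /mmap.
apply: (big_ind I) => // m _.
have [lt|le] := ltnP (mdeg m) (n * \max_i e i).+1.
  by rewrite mulrC; apply: IM; apply: Ig.
have [i lti] : exists i, (\max_i e i < m i)%N.
  apply/existsP; apply: contraTT le; rewrite negb_exists => /forallP ltm.
  rewrite -ltnNge ltnS mdegE -[n in (n * _)%N]card_ord -sum_nat_const.
  by apply: leq_sum => i _; rewrite leqNgt.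
rewrite /mmap1 (bigD1 i) //= mulrA mulrAC.
have lem : (e i <= m i)%N by rewrite (leq_trans _ (ltnW lti)) // leq_bigmax.
by rewrite -(subnK lem) exprD mulrA; apply: IM.
Qed.

Section Duality.
Context {K L : fieldType} {n : nat} (pi : {rmorphism {mpoly K[n]} -> L}).
Hypothesis charK : [pchar K] =i pred0.
Hypothesis pi_surj : forall y : L, exists f, pi f = y.
Local Notation iota := (pi \o @mpolyC n K).
Local Notation tau := (taylor pi).

(** The approximable polynomials are closed under sum and product, so it is enough to treat
    [iota(K)], the generator [z] of [L], and the variables. *)
Lemma taylor_approximation k g : exists f, order_ge k (tau f - g).
Proof.
have [z zP] := primitive_element_quotient _ _ _ pi charK pi_surj.
have [p [cop pdvd]] := minimal_polynomial _ _ _ _ charK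
  (mpoly_quotient_algebraic _ _ _ _ pi_surj z).
have pz : (map_poly iota p).[z] = 0 by apply/pdvd.
have [h [ph pX]] := newton_approximation _ _ k cop.
have /dvdpP[r rE] := newton_approximation_root _ _ iota _ _ z k cop pz ph pX.
pose good g := exists f, order_ge k (tau f - g).
have goodD f1 f2 : good f1 -> good f2 -> good (f1 + f2).
  move=> [a ka] [b kb]; exists (a + b); rewrite rmorphD opprD addrACA.
  exact: order_geD.
have goodM f1 f2 : good f1 -> good f2 -> good (f1 * f2).
  move=> [a ka] [b kb]; exists (a * b).
  have -> : tau (a * b) - f1 * f2 = tau a * (tau b - f2) + f2 * (tau a - f1).
    by rewrite rmorphM; ring.
  by apply: order_geD; apply: order_ge_mull.
have goodK c : good (iota c)%:MP.
  by exists c%:MP => m _; rewrite taylorC subrr mcoeff0.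
have [t tz] := pi_surj z.
have goodz : good z%:MP.
  (* The expansion of [h(t)] minus [z] is a multiple of the [k]-th power of [tau t - z], which has
     no constant term. *)
  exists (adjoin (@mpolyC n K) t h).
  have -> : tau (adjoin (@mpolyC n K) t h) - z%:MP =
      adjoin (@mpolyC n L) (tau t) (map_poly iota h - z%:P).
    rewrite !adjoinE [map_poly _ (_ - _)]rmorphB /= map_polyC hornerD hornerN.
    rewrite hornerC -horner_map -!map_poly_comp.
    congr (_.[_] - _); apply: eq_map_poly => c; exact: taylorC.
  rewrite rE adjoinE rmorphM rmorphXn rmorphB /= map_polyX map_polyC.
  rewrite hornerM horner_exp hornerXsubC.
  apply/order_ge_mull/order_geX/order_ge1P.
  by rewrite mcoeffB taylor_coef0 mcoeffC eqxx mulr1 tz subrr.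
have goodC c : good c%:MP.
  have [q <-] := zP c; elim/poly_ind: q => [|q d IHq].
    by rewrite rmorph0 horner0 -(rmorph0 iota); apply: goodK.
  rewrite rmorphD rmorphM /= map_polyX map_polyC !hornerE rmorphD rmorphM.
  exact: goodD (goodM _ _ IHq goodz) (goodK d).
elim/mpoly_algebra_ind: g => [c|i|f g|f g]; [exact: goodC | | exact: goodD |
  exact: goodM].
have [f kf] := goodC (pi 'X_i); exists ('X_i - f).
rewrite rmorphB taylorX.
have -> : (pi 'X_i)%:MP + 'X_i - tau f - 'X_i = - (tau f - (pi 'X_i)%:MP) by ring.
exact: order_geN.
Qed.

(** With [x] above [z] and [p(x)] in [I], each [X_i] is [q_i(x) + y_i] with [y_i] in the radical of
    [I], and [f] is a polynomial in the [y_i] over [K[x]]. Its coefficients at [z] are those of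
    [tau f]; one that vanishes there is a multiple of [p(x)], so in [I]. Monomials of high degree in
    the [y_i] are in [I] as well. *)
Lemma taylor_order_ideal (I : {mpoly K[n]} -> Prop) : is_ideal I ->
    (forall f, pi f = 0 -> Defs.rad I f) ->
  exists k, forall f, order_ge k (tau f) -> I f.
Proof.
move=> idI radI; have [I0 ID IM] := idI.
have [z zP] := primitive_element_quotient _ _ _ pi charK pi_surj.
have [p [cop pdvd]] := minimal_polynomial _ _ _ _ charK
  (mpoly_quotient_algebraic _ _ _ _ pi_surj z).
have pz : (map_poly iota p).[z] = 0 by apply/pdvd.
have [t tz] := pi_surj z.
have piE q u : pi (adjoin (@mpolyC n K) u q) = (map_poly iota q).[pi u].
  by rewrite adjoinE -horner_map -map_poly_comp.
(* Newton's [h] for this exponent [l] makes [p(h(t))] a multiple of [p(t)^l], hence an element of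
   [I]; [x] will be [h(t)]. *)
have [l pl] : Defs.rad I (adjoin (@mpolyC n K) t p) by apply: radI; rewrite piE tz.
have [h [/dvdpP[r rE] /dvdpP[w wE]]] := newton_approximation _ _ l cop.
pose x := adjoin (@mpolyC n K) t h.
have px : I (adjoin (@mpolyC n K) x p).
  have -> : adjoin (@mpolyC n K) x p = adjoin (@mpolyC n K) t (p \Po h).
    by rewrite !adjoinE map_comp_poly horner_comp.
  by rewrite rE rmorphM rmorphXn; apply: IM.
have pix : pi x = z.
  rewrite piE tz; apply/eqP; rewrite -subr_eq0; apply/eqP.
  have := congr1 (fun q => (map_poly iota q).[z]) wE.
  by rewrite rmorphM rmorphB /= map_polyX !hornerE pz mulr0.
have [q qP] := fin_all_exists (fun i => zP (pi 'X_i)).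
pose y i := 'X_i - adjoin (@mpolyC n K) x (q i).
have radE i : Defs.rad I (y i) by apply: radI; rewrite rmorphB piE pix qP subrr.
have [e eP] := fin_all_exists radE.
(* [s] sends [X_i] to [q_i + Y_i] over [K[T]]. Putting [T = z] gives [tau] ([chart]); putting
   [T = x] and [Y_i = y_i] gives the identity ([lift]). *)
have [s [sC sX]] := mpoly_extension (@mpolyC n {poly K} \o @polyC K)
  (fun i => (q i)%:MP + 'X_i).
have [ev evE] : exists ev : {rmorphism {poly K} -> {mpoly K[n]}},
  forall a, ev a = adjoin (@mpolyC n K) x a by exists (adjoin (@mpolyC n K) x).
have [evz evzE] : exists evz : {rmorphism {poly K} -> L},
  forall a, evz a = (map_poly iota a).[z] by exists (adjoin iota z).
have evC c : ev c%:P = c%:MP by rewrite evE; apply: adjoinC.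
have evzC c : evz c%:P = iota c by rewrite evzE map_polyC hornerC.
have chart f : map_mpoly (evz) (s f) = tau f.
  elim/mpoly_algebra_ind: f => [c|i|f g IHf IHg|f g IHf IHg].
  - rewrite sC taylorC [LHS]map_mpolyC; congr (_%:MP); exact: evzC.
  - rewrite sX taylorX [LHS]rmorphD; congr (_ + _); last exact: map_mpolyX.
    rewrite [LHS]map_mpolyC; congr (_%:MP).
    exact: etrans (evzE _) (qP i).
  - rewrite [s _]rmorphD [LHS]rmorphD rmorphD.
    by congr (_ + _); [exact: IHf | exact: IHg].
  - rewrite [s _]rmorphM [LHS]rmorphM rmorphM.
    by congr (_ * _); [exact: IHf | exact: IHg].
have lift f : mmap (ev) y (s f) = f.
  elim/mpoly_algebra_ind: f => [c|i|f g IHf IHg|f g IHf IHg].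
  - rewrite sC [LHS]mmapC; exact: evC.
  - rewrite sX [LHS]rmorphD -[RHS](subrKC (ev (q i))).
    congr (_ + _); first exact: mmapC.
    by rewrite [LHS]mmapX mmap1U /y -evE.
  - rewrite [s _]rmorphD [LHS]rmorphD; congr (_ + _); [exact: IHf | exact: IHg].
  - rewrite [s _]rmorphM [LHS]rmorphM; congr (_ * _); [exact: IHf | exact: IHg].
exists (n * \max_i e i).+1 => f kf; rewrite -(lift f).
apply: (mmap_ideal _ _ _ _ _ idI eP) => // m ltm.
have /pdvd /dvdpP[u ->] : (map_poly iota (s f)@_m).[z] = 0.
  by have := kf m ltm; rewrite -chart mcoeff_map_mpoly => <-; rewrite -evzE.
by rewrite rmorphM; apply: (IM); rewrite evE.
Qed.

End Duality.

(** * Separation in finite dimension *)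

Definition subspace {F : fieldType} {V : lmodType F} (S : V -> Prop) : Prop :=
  [/\ S 0, (forall u v, S u -> S v -> S (u + v)) & (forall a u, S u -> S (a *: u))].

(** [in_span] has one coefficient per index, counted with the multiplicity of the index in the list.
    So the occurrences of [j] are merged into one, carrying their total plus [a]. *)
Lemma in_spanDl (F : fieldType) (V : lmodType F) (J : Type) (f : J -> V) a j v :
  in_span f v -> in_span f (a *: f j + v).
Proof.
move=> [s [c ->]]; pose isj i : bool := excluded_middle_informative (i = j).
have isjP i : reflect (i = j) (isj i).
  by rewrite /isj; case: excluded_middle_informative => ij; constructor.
exists (j :: [seq i <- s | ~~ isj i]).
exists (fun i => if isj i then a + \sum_(l <- s | isj l) c j else c i).
rewrite big_cons ifT ?scalerDl -?addrA; last exact/isjP.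
rewrite big_filter scaler_suml (bigID isj) /=; congr (_ + (_ + _)).
  by apply: eq_bigr => i /isjP ->.
by apply: eq_bigr => i /negPf ->.
Qed.

Lemma in_span_subspace (F : fieldType) (V : lmodType F) (J : Type) (f : J -> V) :
  subspace (in_span f).
Proof.
split=> [|_ v [s [c ->]] spv|a _ [s [c ->]]].
- by exists [::], (fun=> 0); rewrite big_nil.
- elim: s => [|j s IHs]; first by rewrite big_nil add0r.
  by rewrite big_cons -addrA; apply: in_spanDl.
exists s, (fun j => a * c j); rewrite scaler_sumr.
by apply: eq_bigr => j _; rewrite scalerA.
Qed.

Lemma in_span_family (F : fieldType) (V : lmodType F) (J : Type) (f : J -> V) j :
  in_span f (f j).
Proof. by exists [:: j], (fun=> 1); rewrite big_seq1 scale1r. Qed.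

(** A predicate provides no basis: a matrix is enlarged by vectors of [S] outside its row space
    until none is left, and the rank bounds the number of enlargements. *)
Lemma subspace_matrix (F : fieldType) (d : nat) (S : 'rV[F]_d -> Prop) :
  subspace S -> exists A : 'M[F]_d, forall u, S u <-> (u <= A)%MS.
Proof.
move=> [S0 SD SZ].
suff grow k (A : 'M[F]_d) : (d - \rank A <= k)%N ->
    (forall u : 'rV_d, (u <= A)%MS -> S u) ->
    exists B : 'M[F]_d, forall u, S u <-> (u <= B)%MS.
  by apply: (grow d 0); rewrite ?leq_subr // => u; rewrite submx0 => /eqP ->.
elim: k A => [|k IHk] A rk SA.
  exists A => u; split=> [_|/SA //]; apply/submx_full.
  by rewrite /row_full eqn_leq rank_leq_col -subn_eq0 -leqn0.
have [[u [Su uA]]|full] := classic (exists u, S u /\ ~ (u <= A)%MS); last first.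
  by exists A => u; split=> [Su|/SA //]; apply: NNPP => uA; apply: full; exists u.
have ltA : (A < A + u)%MS.
  by rewrite /ltmx addsmxSl addsmx_sub submx_refl; apply/negP.
apply: (IHk (A + u)%MS) => [|v /sub_addsmxP[[a b] ->]].
  by rewrite -ltnS (leq_trans _ rk) // ltn_sub2l ?rank_ltmx //
    (leq_trans (rank_ltmx ltA)) // rank_leq_col.
apply: (SD); first by apply: SA; apply: submxMl.
rewrite [b]mx11_scalar mul_scalar_mx; exact: SZ.
Qed.

(** With [S] as the row space of [A], a vector outside [S] is not killed by [cokermx A]; a column on
    which it is nonzero is the separating functional. *)
Lemma subspace_separation (F : fieldType) (T : finType)
    (S : {ffun T -> F^o} -> Prop) (v : {ffun T -> F^o}) :
    subspace S -> ~ S v ->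
  exists w : {ffun T -> F^o},
    (forall u, S u -> \sum_t u t * w t = 0) /\ \sum_t v t * w t <> 0.
Proof.
move=> [S0 SD SZ] Sv.
pose vec (u : {ffun T -> F^o}) : 'rV[F]_#|T| := \row_j u (enum_val j).
pose fn (u : 'rV[F]_#|T|) : {ffun T -> F^o} := [ffun t => u 0 (enum_rank t)].
have vecK : cancel vec fn by move=> u; apply/ffunP => t; rewrite !(ffunE, mxE) enum_rankK.
have [|A SA] := subspace_matrix _ _ (fun u => S (fn u)).
  split=> [|u w Su Sw|a u Su].
  - by rewrite (_ : fn 0 = 0) //; apply/ffunP => t; rewrite !(ffunE, mxE).
  - rewrite (_ : fn (u + w) = fn u + fn w); first exact: SD.
    by apply/ffunP => t; rewrite !(ffunE, mxE).
  - rewrite (_ : fn (a *: u) = a *: fn u); first exact: SZ.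
    by apply/ffunP => t; rewrite !(ffunE, mxE).
have : ~~ (vec v <= A)%MS by apply/negP => /SA; rewrite vecK.
rewrite submxE => /rV0Pn[j vj].
have pairE u : (vec u *m cokermx A) 0 j =
    \sum_t u t * [ffun t => cokermx A (enum_rank t) j] t.
  rewrite mxE (reindex enum_rank) /=; last exact/onW_bij/enum_rank_bij.
  by apply: eq_bigr => t _; rewrite !(ffunE, mxE) enum_rankK.
exists [ffun t => cokermx A (enum_rank t) j]; split=> [u Su|].
  rewrite -pairE; have /submxP[D ->] : (vec u <= A)%MS by apply/SA; rewrite vecK.
  by rewrite -mulmxA mulmx_coker mulmx0 mxE.
by rewrite -pairE; apply/eqP.
Qed.

(** * Duality between operators and Taylor coefficients *)

Definition degree_lt {A : comNzRingType} {n : nat} (k : nat) (g : {mpoly A[n]}) : Prop :=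
  forall m, (k <= mdeg m)%N -> g@_m = 0.

Definition jet {A : comNzRingType} {n : nat} (k : nat) (g : {mpoly A[n]}) :
  {ffun 'X_{1..n < k} -> A^o} := [ffun t : 'X_{1..n < k} => g@_t].

(** The weights [m!] turn the pairing with [f] into the dot product with the jet of [tau f]. *)
Definition cojet {A : comNzRingType} {n : nat} (k : nat) (E : {mpoly A[n]}) :
  {ffun 'X_{1..n < k} -> A^o} :=
  [ffun t : 'X_{1..n < k} => E@_t *+ (\prod_(i < n) ((t : 'X_{1..n}) i)`!)].

Section Jets.
Context {A : comNzRingType} {n : nat}.
Implicit Types (g h E : {mpoly A[n]}) (k : nat).

Lemma degree_lt_msize k g : (msize g <= k)%N -> degree_lt k g.
Proof.
move=> le m lem; apply: memN_msupp_eq0; apply: msize_mdeg_ge.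
exact: leq_trans lem.
Qed.

(** Supports vary from one operator to another; over a fixed finite set of monomials the sums can be
    compared termwise. *)
Lemma sum_msupp_widen (V : nmodType) k E (F : A -> 'X_{1..n} -> V) :
    degree_lt k E -> (forall m, F 0 m = 0) ->
  \sum_(m <- msupp E) F E@_m m = \sum_(t : 'X_{1..n < k}) F E@_t t.
Proof.
move=> ltE F0; pose T : subFinType _ := 'X_{1..n < k}.
rewrite (big_mksub T) ?msupp_uniq //=; last first.
  move=> m; rewrite mcoeff_msupp => Em; rewrite ltnNge.
  by apply: contraNN Em => /ltE ->.
by rewrite big_rmcond //= => t /memN_msupp_eq0 ->.
Qed.

Lemma jet_eqP k g h : jet k g = jet k h <-> order_ge k (g - h).
Proof.
split=> [eqj m lt|ord]; last first.
  apply/ffunP => t; rewrite !ffunE; apply/eqP; rewrite -subr_eq0 -mcoeffB.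
  by rewrite ord // bmdeg.
move/ffunP/(_ (BMultinom lt)): eqj; rewrite !ffunE /= => eqg.
by rewrite mcoeffB eqg subrr.
Qed.

Lemma jet_exists k (u : {ffun 'X_{1..n < k} -> A^o}) : exists g, jet k g = u.
Proof.
pose c (m : 'X_{1..n}) := if insub m is Some t then u t else 0.
exists (\sum_(t : 'X_{1..n < k}) c t *: 'X_[t]).
by apply/ffunP => t; rewrite ffunE (mcoeff_mpoly c) ?bmdeg // /c valK.
Qed.

Lemma jet0 k : jet k (0 : {mpoly A[n]}) = 0.
Proof. by apply/ffunP => t; rewrite !ffunE mcoeff0. Qed.

Lemma jetD k g h : jet k (g + h) = jet k g + jet k h.
Proof. by apply/ffunP => t; rewrite !ffunE mcoeffD. Qed.

Lemma jetZ k a g : jet k (a *: g) = a *: jet k g.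
Proof. by apply/ffunP => t; rewrite !ffunE mcoeffZ. Qed.

Lemma cojetD k g h t : cojet k (g + h) t = cojet k g t + cojet k h t :> A.
Proof. by rewrite !ffunE mcoeffD mulrnDl. Qed.

Lemma cojetZ k a g t : cojet k (a *: g) t = a * cojet k g t :> A.
Proof. by rewrite !ffunE mcoeffZ -mulrnAr. Qed.

Lemma cojet_sum k (J : Type) (s : seq J) (c : J -> A) (F : J -> {mpoly A[n]}) :
  cojet k (\sum_(j <- s) c j *: F j) = \sum_(j <- s) c j *: cojet k (F j).
Proof.
elim: s => [|j s IHs]; apply/ffunP => t.
  by rewrite !big_nil !ffunE mcoeff0 mul0rn.
by rewrite !big_cons [LHS]cojetD cojetZ IHs !ffunE.
Qed.

End Jets.

Section CharZero.
Context {L : fieldType} {n : nat}.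
Hypothesis charL : [pchar L] =i pred0.

Lemma mulrn_fact_eq0 (m : 'X_{1..n}) (x : L) :
  x *+ (\prod_(i < n) (m i)`!) = 0 -> x = 0.
Proof.
move=> /eqP; rewrite -mulr_natr mulf_eq0 => /orP[/eqP //|].
move/pcharf0P: charL => ->; rewrite -leqn0 leqNgt prodn_gt0 // => i.
exact: fact_gt0.
Qed.

Lemma cojet_exists k (w : {ffun 'X_{1..n < k} -> L^o}) :
  exists2 E : {mpoly L[n]}, degree_lt k E & cojet k E = w.
Proof.
pose c (m : 'X_{1..n}) := if insub m is Some t then
  w t / (\prod_(i < n) (m i)`!)%:R else 0.
exists (\sum_(t : 'X_{1..n < k}) c t *: 'X_[t]) => [m lem|].
  rewrite raddf_sum big1 //= => t _; rewrite mcoeffZ mcoeffX.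
  case: eqP => [tm|]; last by rewrite mulr0.
  by have := bmdeg t; rewrite tm ltnNge lem.
apply/ffunP => t; rewrite ffunE (mcoeff_mpoly c) ?bmdeg // /c valK.
rewrite -[LHS]mulr_natr; apply: divfK; apply/eqP => /mulrn_fact_eq0/eqP.
by rewrite oner_eq0.
Qed.

Lemma cojet_inj k (E E' : {mpoly L[n]}) :
  degree_lt k E -> degree_lt k E' -> cojet k E = cojet k E' -> E = E'.
Proof.
move=> kE kE' eqE; apply/mpolyP => m; have [le|lt] := leqP k (mdeg m).
  by rewrite kE // kE'.
move/ffunP/(_ (BMultinom lt)): eqE; rewrite !ffunE /= => /eqP.
by rewrite -subr_eq0 -mulrnBl => /eqP/mulrn_fact_eq0/eqP; rewrite subr_eq0 => /eqP.
Qed.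

End CharZero.

Section Pairing.
Context {K L : fieldType} {n : nat} (pi : {rmorphism {mpoly K[n]} -> L}).
Local Notation tau := (taylor pi).
Implicit Types (E : {mpoly L[n]}) (f : {mpoly K[n]}).

Lemma pairing_jet k E f : degree_lt k E ->
  pairing pi E f = \sum_t jet k (tau f) t * cojet k E t.
Proof.
move=> ltE; rewrite /pairing.
rewrite (sum_msupp_widen _ k _ (fun c m => c * pi (f^`M[m]))) // => [|m].
  by apply: eq_bigr => t _; rewrite !ffunE pi_mderivm mulrnAr mulrC mulrnAr.
by rewrite mul0r.
Qed.

Lemma pairing_sum (J : Type) (s : seq J) (c : J -> L) (F : J -> {mpoly L[n]}) f :
  pairing pi (\sum_(j <- s) c j *: F j) f = \sum_(j <- s) c j * pairing pi (F j) f.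
Proof.
have pairingE E k : (msize E <= k)%N ->
    pairing pi E f = \sum_t jet k (tau f) t * cojet k E t.
  by move=> /degree_lt_msize; apply: pairing_jet.
have pD E1 E2 : pairing pi (E1 + E2) f = pairing pi E1 f + pairing pi E2 f.
  set k := maxn (msize (E1 + E2)) (maxn (msize E1) (msize E2)).
  rewrite !(pairingE _ k) ?leq_max ?leqnn ?orbT // -big_split.
  by apply: eq_bigr => t _; rewrite cojetD mulrDr.
have pZ a E : pairing pi (a *: E) f = a * pairing pi E f.
  set k := maxn (msize (a *: E)) (msize E).
  rewrite !(pairingE _ k) ?leq_max ?leqnn ?orbT // mulr_sumr.
  by apply: eq_bigr => t _; rewrite cojetZ mulrCA.
elim: s => [|j s IHs]; last by rewrite !big_cons pD pZ IHs.
by rewrite !big_nil /pairing msupp0 big_nil.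
Qed.

Lemma pi_weyl_act (N : weyl K n) f :
  pi (weyl_act N f) = pairing pi (weyl_red pi N) f.
Proof.
pose k := msize N.
have ltN : degree_lt k N by apply: degree_lt_msize.
have ltE : degree_lt k (weyl_red pi N).
  by move=> m /ltN; rewrite /weyl_red mcoeff_map_mpoly => ->; exact: rmorph0.
rewrite /weyl_act (sum_msupp_widen _ k _ (fun c m => c * f^`M[m])) //; last first.
  by move=> m; rewrite mul0r.
rewrite /pairing (sum_msupp_widen _ k _ (fun c m => c * pi (f^`M[m]))) //; last first.
  by move=> m; rewrite mul0r.
rewrite rmorph_sum; apply: eq_bigr => t _.
by rewrite rmorphM /weyl_red mcoeff_map_mpoly.
Qed.

End Pairing.

(** * The local dual as the annihilator of the jets of [I] *)

Section LocalDual.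
Context {K L : fieldType} {n : nat} (pi : {rmorphism {mpoly K[n]} -> L}).
Variable I : {mpoly K[n]} -> Prop.
Hypothesis charK : [pchar K] =i pred0.
Hypothesis charL : [pchar L] =i pred0.
Hypothesis pi_surj : forall y : L, exists f, pi f = y.
Hypothesis idI : is_ideal I.
Variable k : nat.
Hypothesis order_I : forall f, order_ge k (taylor pi f) -> I f.
Local Notation tau := (taylor pi).
Local Notation approx := (taylor_approximation pi charK pi_surj).

Lemma jet_taylor_surj (u : {ffun 'X_{1..n < k} -> L^o}) :
  exists f, jet k (tau f) = u.
Proof.
have [g <-] := jet_exists k u; have [f fg] := approx k g.
by exists f; apply/jet_eqP.
Qed.

(* The scalar [a] of [L] acts on jets as multiplication by any [h] in [R] whose
   Taylor expansion is [a] to order [k]: this makes the jets of [I] an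
   [L]-subspace. *)
Lemma jet_ideal_subspace : subspace (fun u => exists2 f, I f & jet k (tau f) = u).
Proof.
have [I0 ID IM] := idI; split.
- by exists 0 => //; rewrite rmorph0 jet0.
- by move=> _ _ [f If <-] [g Ig <-]; exists (f + g); rewrite ?rmorphD ?jetD //; apply: ID.
move=> a _ [f If <-]; have [h ha] := approx k a%:MP.
exists (h * f); first exact: IM.
rewrite -jetZ; apply/jet_eqP; rewrite rmorphM -mul_mpolyC -mulrBl mulrC.
exact: order_ge_mull.
Qed.

(** If the jet of [f] were that of some [g] in [I], the difference would have Taylor order at least
    [k] and lie in [I]. So a functional separates it from the jets of [I], and this functional is
    the cojet of an operator. *)
Lemma local_dual_separates f : ~ I f ->
  exists2 E, local_dual pi I E & pairing pi E f <> 0.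
Proof.
move=> nIf; have [I0 ID IM] := idI.
have [|w [wI wf]] := subspace_separation _ _ _ (jet k (tau f)) jet_ideal_subspace.
  move=> [g Ig /jet_eqP]; rewrite -rmorphB => /order_I Igf; apply: nIf.
  have -> : f = g + (-1) * (g - f) by ring.
  by apply: (ID) => //; apply: IM.
have [E ltE Ew] := cojet_exists charL k w.
exists E; last by rewrite (pairing_jet _ k) // Ew.
by move=> g Ig; rewrite (pairing_jet _ k) // Ew; apply: wI; exists g.
Qed.

(** For [m] of degree at least [k], some [f] has expansion [y^m] modulo [M^l], with [l] beyond [m]
    and all of [E]. It lies in [I], and its pairing with [E] is [m!] times the coefficient of [E] at
    [m]. *)
Lemma local_dual_degree E : local_dual pi I E -> degree_lt k E.
Proof.
move=> dualE m lem; pose l := maxn (msize E) (mdeg m).+1.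
have lel : (k <= l)%N by rewrite (leq_trans lem) // (leq_trans (leqnSn _)) // leq_maxr.
have ltm : (mdeg m < l)%N by rewrite leq_max leqnn orbT.
have [f fm] := approx l 'X_[m].
have If : I f.
  apply: order_I => m' lt; have := fm m' (leq_trans lt lel).
  rewrite mcoeffB mcoeffX; case: eqP => [mm'|_]; last by rewrite subr0.
  by move: lt; rewrite -mm' ltnNge lem.
have ltE : degree_lt l E by apply: degree_lt_msize; rewrite leq_max leqnn.
have := dualE f If; rewrite (pairing_jet _ l) // (_ : jet l _ = jet l 'X_[m]).
  rewrite (bigD1 (BMultinom ltm)) //= big1 => [|t tm].
    by rewrite !ffunE /= mcoeffX eqxx mul1r addr0 => /(mulrn_fact_eq0 charL).
  rewrite ffunE mcoeffX; case: eqP => [mt|_]; last by rewrite mul0r.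
  by case/eqP: tm; apply: val_inj; rewrite /= mt.
exact/jet_eqP.
Qed.

(** If the cojet of [E] were outside the span, some [u] would annihilate the cojets of all [F j] but
    not that of [E]. As [u] is the jet of some [tau f], this [f] is in [I] and pairs nontrivially
    with [E], a contradiction. *)
Lemma spans_local_dual (J : Type) (F : J -> {mpoly L[n]}) :
    (forall j, local_dual pi I (F j)) ->
    (forall f, (forall j, pairing pi (F j) f = 0) -> I f) ->
  spans F (local_dual pi I).
Proof.
move=> dualF sepF E; split=> [dualE|[s [c ->]] f If]; last first.
  by rewrite pairing_sum big1 // => j _; rewrite dualF ?mulr0.
have [[s [c Ec]]|nSE] := classic (in_span (fun j => cojet k (F j)) (cojet k E)).
  exists s, c; apply: (cojet_inj charL k); first exact: local_dual_degree.
    move=> m lem; rewrite raddf_sum big1 //= => j _.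
    by rewrite mcoeffZ local_dual_degree ?mulr0.
  by rewrite cojet_sum.
have [u [uF uE]] := subspace_separation _ _ _ _ (in_span_subspace _ _ _ _) nSE.
have [f fu] := jet_taylor_surj u.
have swap E' : local_dual pi I E' -> pairing pi E' f = \sum_t cojet k E' t * u t.
  move=> dualE'; rewrite (pairing_jet _ k) ?fu; last exact: local_dual_degree.
  by apply: eq_bigr => t _; rewrite mulrC.
case: uE; rewrite -swap //; apply: dualE; apply: sepF => j.
rewrite swap //; apply: uF; exact: in_span_family.
Qed.

End LocalDual.

Theorem theorem3p10 (K : fieldType) (n : nat)
  (hK : [pchar K] =i pred0)
  (P I : {mpoly K[n]} -> Prop)
  (hP : is_maximal_ideal P) (hI : is_P_primary P I)
  (L : fieldType) (pi : {rmorphism {mpoly K[n]} -> L})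
  (pi_surj : forall y : L, exists f, pi f = y)
  (pi_ker : forall f, pi f = 0 <-> P f) :
  (forall (iota : Type) (D : iota -> {mpoly L[n]}) (N : iota -> weyl K n),
      spans D (local_dual pi I) ->
      (forall i, weyl_red pi (N i) = D i) ->
      noetherian_ops N I)
  /\
  (forall (iota : Type) (N : iota -> weyl K n),
      noetherian_ops N I ->
      spans (fun i => weyl_red pi (N i)) (local_dual pi I)).
Proof.
have [[idI _ _] radI] := hI.
have rad_pi f : Defs.rad I f <-> pi f = 0.
  by split=> [/radI/pi_ker|/pi_ker/radI].
have charL : [pchar L] =i pred0.
  by move=> p; rewrite -(hK p) (fmorph_pchar (pi \o @mpolyC n K)).
have [k order_I] := taylor_order_ideal pi hK pi_surj _ idI (fun f => proj2 (rad_pi f)).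
(* The radical of [I] is the kernel of [pi], so the Noetherian condition on [N i] is a condition on
   its image alone. *)
have actE iota (N : iota -> weyl K n) i f :
    Defs.rad I (weyl_act (N i) f) <-> pairing pi (weyl_red pi (N i)) f = 0.
  by rewrite rad_pi pi_weyl_act.
split=> [iota D N spanD ND f|iota N noethN].
  split=> [If i|Nf].
    by apply/actE; rewrite ND; apply: (proj2 (spanD _) (in_span_family _ _ _ D i)).
  apply: NNPP => nIf.
  have [E /spanD[s [c ->]] Ef] :=
    local_dual_separates pi _ hK charL pi_surj idI _ order_I f nIf.
  apply: Ef; rewrite pairing_sum big1 // => i _.
  by rewrite -ND (proj1 (actE _ _ _ _) (Nf i)) mulr0.
(* The two directions of the Noetherian condition say that the images lie in the local dual and that
   they detect [I]. *)
apply: (spans_local_dual pi _ hK charL pi_surj _ order_I) => [i f If|f Nf].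
  by apply/actE; apply: (proj1 (noethN f)).
by apply/noethN => i; apply/actE.
Qed.
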